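(* Let $\mathcal{N}(1,2,1)$ be the moduli space of framed stable representations of the enhanced ADHM quiver of numerical type $(1,2,1)$, and let $X=(A,B,I,J,A',B',F)$ be a framed stable representation. Then the $2$-form $\Omega_X$ on $T_X\mathcal{N}(1,2,1)$ is non-degenerate if and only if the endomorphisms $A$ and $B$ are (both) diagonalizable.
   Context: Let $W,V,V'$ be complex vector spaces of dimensions $1,2,1$. A framed stable representation of the enhanced ADHM quiver of numerical type $(1,2,1)$ is $X=(A,B,I,J,A',B',F)$ with $A,B\in\mathrm{End}(V)$, $I\in\mathrm{Hom}(W,V)$, $J\in\mathrm{Hom}(V,W)$, $A',B'\in\mathrm{End}(V')$, $F\in\mathrm{Hom}(V',V)$ satisfying $[A,B]+IJ=0$, $[A',B']=0$, $AF-FA'=0$, $BF-FB'=0$, $JF=0$, and stable: (S.1) $F$ is injective; (S.2) there is no proper subspace $S\subsetneq V$ with $A(S),B(S)\subset S$ and $\mathrm{Im}(I)\subset S$. The group $GL(V)\times GL(V')$ acts freely by $(h,h')\cdot X=(hAh^{-1},hBh^{-1},hI,Jh^{-1},h'A'h'^{-1},h'B'h'^{-1},hFh'^{-1})$ and $\mathcal{N}(1,2,1)$ is the quotient, a smooth variety. Its tangent space at $X$ is $T_X\mathcal{N}(1,2,1)=\ker d_1/\mathrm{im}\,d_0$, where $d_0(h,h')=([h,A],[h,B],hI,-Jh,[h',A'],[h',B'],hF-Fh')$ for $(h,h')\in\mathrm{End}(V)\oplus\mathrm{End}(V')$, and $d_1(a,b,i,j,a',b',f)=([a,B]+[A,b]+Ij+iJ,\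 Af+aF-Fa'-fA',\ Bf+bF-Fb'-fB',\ jF+Jf)$ for $(a,b,i,j,a',b',f)\in\mathrm{End}(V)^{\oplus2}\oplus\mathrm{Hom}(W,V)\oplus\mathrm{Hom}(V,W)\oplus\mathrm{End}(V')^{\oplus2}\oplus\mathrm{Hom}(V',V)$. The holomorphic $2$-form $\Omega$ is given on classes of $x_k=(a_k,b_k,i_k,j_k,a'_k,b'_k,f_k)\in\ker d_1$, $k=1,2$, by $\Omega_X(x_1,x_2)=\mathrm{tr}(-a_2b_1+b_2a_1-i_2j_1+i_1j_2-a'_2b'_1+b'_2a'_1)$. Non-degenerate means that $u\mapsto\Omega_X(u,\cdot)$ is an isomorphism $T_X\mathcal{N}(1,2,1)\to(T_X\mathcal{N}(1,2,1))^*$. *)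

(* Defs.v *)
From HB Require Import structures.
From mathcomp Require Import all_boot all_order all_algebra.
From mathcomp Require Import generic_quotient ring_quotient.
From mathcomp Require Import ring.

Set Implicit Arguments.
Unset Strict Implicit.
Unset Printing Implicit Defensive.

Import GRing.Theory.
Import passmx.

Local Open Scope ring_scope.
Local Open Scope quotient_scope.

(* The library composition \o has the same level as + and -. *)
Local Notation "f ** g" := (comp_lfun f g) (at level 40, left associativity).

Section QuotientVectorSpace.
Import VectorInternalTheory.
Variables (K : fieldType) (vT : vectType K) (U : {vspace vT}).

Definition quotv : Type := Quotient.quot (pred_of_vspace U).

HB.instance Definition _ := Choice.on quotv.
HB.instance Definition _ := GRing.Zmodule.on quotv.

Definition piv (x : vT) : quotv := \pi_(Quotient.quot (pred_of_vspace U)) x.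
Definition reprv (q : quotv) : vT := repr q.

Lemma reprvK q : piv (reprv q) = q. Proof. exact: reprK. Qed.

Lemma piv_eq x y : (piv x == piv y) = (x - y \in U).
Proof. by rewrite -[RHS]/(Quotient.equiv _ x y) Quotient.equivE Quotient.idealrBE. Qed.

Lemma reprv_piv x : reprv (piv x) - x \in U.
Proof. by rewrite -piv_eq reprvK. Qed.

Lemma reprv_compat2 (T : Type) (w : vT -> vT -> T) x y :
  (forall x1 x2 z, x1 - x2 \in U -> w x1 z = w x2 z) ->
  (forall x1 x2 z, x1 - x2 \in U -> w z x1 = w z x2) ->
  w (reprv (piv x)) (reprv (piv y)) = w x y.
Proof.
move=> wl wr; rewrite (wl _ _ _ (reprv_piv x)).
exact: wr (reprv_piv y).
Qed.

Lemma pivB : {morph piv : x y / x - y}.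
Proof. exact: raddfB. Qed.

Lemma pivD : {morph piv : x y / x + y}.
Proof. exact: raddfD. Qed.

Definition scalev (a : K) (q : quotv) : quotv := piv (a *: reprv q).

Lemma piv_scale a x : scalev a (piv x) = piv (a *: x).
Proof. by apply/eqP; rewrite piv_eq -scalerBr rpredZ ?reprv_piv. Qed.

Fact scalevA a b q : scalev a (scalev b q) = scalev (a * b) q.
Proof. by rewrite -[q]reprvK !piv_scale scalerA. Qed.
Fact scale1v : left_id 1 scalev.
Proof. by move=> q; rewrite -[q]reprvK piv_scale scale1r. Qed.
Fact scalevDr : right_distributive scalev +%R.
Proof.
by move=> a p q; rewrite -[p]reprvK -[q]reprvK -pivD !piv_scale -pivD scalerDr.
Qed.
Fact scalevDl q : {morph scalev^~ q : a b / a + b}.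
Proof. by move=> a b; rewrite -[q]reprvK !piv_scale -pivD scalerDl. Qed.

HB.instance Definition _ :=
  GRing.Zmodule_isLmodule.Build K quotv scalevA scale1v scalevDr scalevDl.

Lemma piv_is_linear : linear piv.
Proof. by move=> a x y; rewrite pivD -piv_scale. Qed.
HB.instance Definition _ := GRing.isSemilinear.Build K vT quotv _ piv
  (GRing.semilinear_linear piv_is_linear).

Fact quotv_vect_iso : Vector.axiom (dim (subvs_of U^C)) quotv.
Proof.
pose p x := v2r (vsproj U^C%VS (daddv_pi U^C U x)).
have cap0 : (U^C :&: U = 0)%VS by rewrite capvC capv_compl.
have pU x : x \in U -> p x = 0.
  move=> xU; rewrite /p (_ : daddv_pi _ _ x = 0) ?linear0 //.
  have := daddv_pi_add cap0 (w := x); rewrite addvC addv_complf memvf => /(_ isT).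
  have Ucap : (U :&: U^C = 0)%VS by rewrite capv_compl.
  by rewrite (daddv_pi_id Ucap xU) => /(canRL (addrK _)) ->; rewrite subrr.
have pB x y : p (x - y) = p x - p y by rewrite /p !linearB.
have prep x : p (reprv (piv x)) = p x.
  by apply/eqP; rewrite -subr_eq0 -pB pU ?reprv_piv.
exists (fun q => p (reprv q)).
  move=> a q r /=; rewrite -[q]reprvK -[r]reprvK -linearP !prep /p.
  by rewrite !linearP.
exists (fun w => piv (vsval (r2v w : subvs_of U^C))) => [q|w].
  rewrite -[RHS]reprvK /p v2rK vsprojK ?memv_pi //; apply/eqP.
  rewrite piv_eq -opprB rpredN.
  have := daddv_pi_add cap0 (w := reprv q).
  rewrite addvC addv_complf memvf => /(_ isT) eq_q.
  by rewrite -{1}eq_q addrAC subrr add0r memv_pi.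
by rewrite prep /p daddv_pi_id ?subvsP // vsvalK r2vK.
Qed.
HB.instance Definition _ := Lmodule_hasFinDim.Build K quotv quotv_vect_iso.

End QuotientVectorSpace.

Section Endomorphisms.
Variable K : fieldType.
Implicit Types U V : vectType K.

Definition lftrace U (f : 'End(U)) : K :=
  \tr (mxof (vbasis {:U}) (vbasis {:U}) f).

Lemma lftraceP U a (f g : 'End(U)) :
  lftrace (a *: f + g) = a * lftrace f + lftrace g.
Proof. by rewrite /lftrace linearP /= linearP. Qed.

HB.instance Definition _ U := GRing.isSemilinear.Build K 'End(U) K _ (@lftrace U)
  (GRing.semilinear_linear (@lftraceP U)).

Lemma lftraceC U V (f : 'Hom(U, V)) (g : 'Hom(V, U)) :
  lftrace (f ** g) = lftrace (g ** f).
Proof.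
rewrite /lftrace (mxof_comp _ _ (vbasisP {:U})).
by rewrite (mxof_comp _ _ (vbasisP {:V})) mxtrace_mulC.
Qed.

Definition diagonalizable_end U (f : 'End(U)) : Prop :=
  exists2 e : (\dim {:U}).-tuple U, basis_of {:U} e & is_diag_mx (mxof e e f).

Definition lfcomm U (f g : 'End(U)) : 'End(U) := f ** g - g ** f.

Lemma coord_inj U (x y : U) :
  (forall i, coord (vbasis {:U}) i x = coord (vbasis {:U}) i y) -> x = y.
Proof.
move=> eq_xy; rewrite (coord_vbasis (memvf x)) (coord_vbasis (memvf y)).
by apply: eq_bigr => i _; rewrite eq_xy.
Qed.

Section Linearity.
Variable T : lmodType K.
Implicit Types x y : T.
Lemma lin_opp k x y : - (k *: x + y) = k *: (- x) + - y.
Proof. by rewrite opprD scalerN. Qed.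
Lemma lin_add k x y x' y' :
  (k *: x + y) + (k *: x' + y') = k *: (x + x') + (y + y').
Proof. by rewrite scalerDr addrACA. Qed.
End Linearity.

Lemma compPl U1 U2 U3 k (f1 f2 : 'Hom(U2, U3)) (g : 'Hom(U1, U2)) :
  (k *: f1 + f2) ** g = k *: (f1 ** g) + f2 ** g.
Proof. by rewrite comp_lfunDl comp_lfunZl. Qed.
Lemma compPr U1 U2 U3 k (g1 g2 : 'Hom(U1, U2)) (f : 'Hom(U2, U3)) :
  f ** (k *: g1 + g2) = k *: (f ** g1) + f ** g2.
Proof. by rewrite comp_lfunDr comp_lfunZr. Qed.

Lemma lfcomm_dim1 U (f g : 'End(U)) : \dim {:U} = 1%N -> lfcomm f g = 0.
Proof.
move=> dimU; apply/eqP; rewrite /lfcomm subr_eq0; apply/eqP.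
apply: (can_inj (mxofK (vbasisP {:U}) (vbasisP {:U}))).
rewrite !(mxof_comp _ _ (vbasisP {:U})).
move: (mxof _ _ f) (mxof _ _ g); rewrite dimU => M N.
by rewrite [M]mx11_scalar scalar_mxC.
Qed.

End Endomorphisms.

Section EnhancedADHM.
Variables (K : fieldType) (W V V' : vectType K).

(* Both the data (A, B, I, J, A', B', F) and their infinitesimal deformations
   (a, b, i, j, a', b', f) live in this space. *)
Definition adhm_space : vectType K :=
  ('End(V) * 'End(V) * 'Hom(W, V) * 'Hom(V, W) * 'End(V') * 'End(V')
   * 'Hom(V', V))%type.

Definition adhm_representation (X : adhm_space) : Prop :=
  let: (A, B, I_, J, A', B', F) := X in
  [/\ lfcomm A B + I_ ** J = 0,
      lfcomm A' B' = 0,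
      A ** F - F ** A' = 0,
      B ** F - F ** B' = 0
    & J ** F = 0].

Definition adhm_stable (X : adhm_space) : Prop :=
  let: (A, B, I_, J, A', B', F) := X in
  injective F /\
  ~ (exists S : {vspace V},
       [/\ S != {:V}%VS, (A @: S <= S)%VS, (B @: S <= S)%VS
         & (limg I_ <= S)%VS]).

Definition d0_fun (X : adhm_space) (x : 'End(V) * 'End(V')) : adhm_space :=
  let: (A, B, I_, J, A', B', F) := X in
  let: (h, h') := x in
  (lfcomm h A, lfcomm h B, h ** I_, - (J ** h),
   lfcomm h' A', lfcomm h' B', h ** F - F ** h').

Definition d1_fun (X x : adhm_space) :
    'End(V) * 'Hom(V', V) * 'Hom(V', V) * 'Hom(V', W) :=
  let: (A, B, I_, J, A', B', F) := X in
  let: (a, b, i, j, a', b', f) := x in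
  (lfcomm a B + lfcomm A b + I_ ** j + i ** J,
   A ** f + a ** F - F ** a' - f ** A',
   B ** f + b ** F - F ** b' - f ** B',
   j ** F + J ** f).

Lemma d0_fun_is_linear X : linear (d0_fun X).
Proof.
case: X => [[[[[[A B] I_] J] A'] B'] F] k [h1 h1'] [h2 h2'].
rewrite /d0_fun /lfcomm /=; do 6?[congr pair];
  by rewrite !(compPl, compPr) ?lin_opp ?lin_add.
Qed.

Lemma d1_fun_is_linear X : linear (d1_fun X).
Proof.
case: X => [[[[[[A B] I_] J] A'] B'] F] k
  [[[[[[a1 b1] i1] j1] a1'] b1'] f1] [[[[[[a2 b2] i2] j2] a2'] b2'] f2].
rewrite /d1_fun /lfcomm /=; do 3?[congr pair];
  by rewrite !(compPl, compPr) ?lin_opp !lin_add ?lin_opp ?lin_add.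
Qed.

HB.instance Definition _ X := GRing.isSemilinear.Build K _ _ _ (d0_fun X)
  (GRing.semilinear_linear (d0_fun_is_linear X)).
HB.instance Definition _ X := GRing.isSemilinear.Build K _ _ _ (d1_fun X)
  (GRing.semilinear_linear (d1_fun_is_linear X)).

Definition d0 X := linfun (d0_fun X).
Definition d1 X := linfun (d1_fun X).

Lemma d1_d0 X x : adhm_representation X -> d1 X (d0 X x) = 0.
Proof.
rewrite !lfunE /=; case: X => [[[[[[A B] I_] J] A'] B'] F].
case: x => h h' [AB A'B' AF BF JF] /=.
have eqIJ : I_ ** J = B ** A - A ** B.
  by apply/eqP; rewrite -subr_eq0 opprB addrC; apply/eqP.
have eqAF : A ** F = F ** A' by apply/eqP; rewrite -subr_eq0; apply/eqP.
have eqBF : B ** F = F ** B' by apply/eqP; rewrite -subr_eq0; apply/eqP.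
rewrite /lfcomm; congr (_, _, _, _);
  rewrite !(comp_lfunDl, comp_lfunDr, comp_lfunNl, comp_lfunNr) -?comp_lfunA.
- rewrite [I_ ** (J ** _)]comp_lfunA eqIJ.
  rewrite !(comp_lfunDl, comp_lfunDr, comp_lfunNl, comp_lfunNr) -?comp_lfunA.
  by apply: coord_inj => i; rewrite !(raddfD, raddfN, raddf0) /=; ring.
- rewrite !eqAF [A ** (F ** _)]comp_lfunA eqAF -?comp_lfunA.
  by apply: coord_inj => i; rewrite !(raddfD, raddfN, raddf0) /=; ring.
- rewrite !eqBF [B ** (F ** _)]comp_lfunA eqBF -?comp_lfunA.
  by apply: coord_inj => i; rewrite !(raddfD, raddfN, raddf0) /=; ring.
- rewrite [J ** (F ** _)]comp_lfunA JF comp_lfun0l subr0.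
  by rewrite addrC subrr.
Qed.

(* ker d1 / im d0, with im d0 seen inside ker d1 (see d1_d0). *)
Definition im_d0_in_ker_d1 X : {vspace subvs_of (lker (d1 X))} :=
  (linfun vsval @^-1: limg (d0 X))%VS.

Definition tangent X : vectType K := quotv (im_d0_in_ker_d1 X).

Definition tangent_class X (x : subvs_of (lker (d1 X))) : tangent X :=
  piv (im_d0_in_ker_d1 X) x.

(* The trace of an element of End(V) + End(V') is the sum of the two traces. *)
Definition omega (x1 x2 : adhm_space) : K :=
  let: (a1, b1, i1, j1, a1', b1', f1) := x1 in
  let: (a2, b2, i2, j2, a2', b2', f2) := x2 in
  lftrace (- (a2 ** b1) + b2 ** a1 - i2 ** j1 + i1 ** j2)
  + lftrace (- (a2' ** b1') + b2' ** a1').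

Lemma omegaC x1 x2 : omega x1 x2 = - omega x2 x1.
Proof.
case: x1 x2 => [[[[[[a1 b1] i1] j1] a1'] b1'] f1].
case=> [[[[[[a2 b2] i2] j2] a2'] b2'] f2].
rewrite /omega !(raddfD, raddfN) /=.
rewrite [lftrace (a2 ** _)]lftraceC [lftrace (b2 ** _)]lftraceC.
rewrite [lftrace (a2' ** _)]lftraceC [lftrace (b2' ** _)]lftraceC.
ring.
Qed.

Lemma omegaPl k x y z : omega (k *: x + y) z = k * omega x z + omega y z.
Proof.
case: x y z => [[[[[[a1 b1] i1] j1] a1'] b1'] f1].
case=> [[[[[[a2 b2] i2] j2] a2'] b2'] f2].
case=> [[[[[[a3 b3] i3] j3] a3'] b3'] f3].
rewrite /omega /= !(compPl, compPr) !(raddfD, raddfN) /=.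
rewrite -?scaleNr !linearZ /= ; ring.
Qed.

Lemma omegaPr k x y z : omega z (k *: x + y) = k * omega z x + omega z y.
Proof. by rewrite omegaC omegaPl opprD -mulrN -!omegaC. Qed.

Lemma omega_d0 X h x :
  \dim {:V'} = 1%N -> d1 X x = 0 -> omega (d0 X h) x = 0.
Proof.
move=> dimV'; rewrite !lfunE /=; case: X => [[[[[[A B] I_] J] A'] B'] F].
case: h x => h h' [[[[[[a b] i] j] a'] b'] f] /= [eq1 _ _ _].
have := congr1 (fun g => lftrace (h ** g)) eq1.
rewrite /= !(lfcomm_dim1 _ _ dimV') !comp_lfun0r /lfcomm.
rewrite !(comp_lfunDl, comp_lfunDr, comp_lfunNl, comp_lfunNr).
rewrite !(raddfD, raddfN, raddf0) /=.
move=> tr_eq1; rewrite -[RHS]tr_eq1.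
rewrite [lftrace (a ** (h ** B))]lftraceC [lftrace (b ** (h ** A))]lftraceC.
rewrite [a ** (B ** h)]comp_lfunA [b ** (A ** h)]comp_lfunA.
rewrite [i ** (J ** h)]comp_lfunA.
rewrite [lftrace (a ** B ** h)]lftraceC [lftrace (b ** A ** h)]lftraceC.
rewrite [lftrace (i ** J ** h)]lftraceC -!comp_lfunA.
ring.
Qed.

(* Omega_X on classes, evaluated on representatives; Omega_class shows that
   the choice is irrelevant when dim V' = 1. *)
Definition Omega X (u v : tangent X) : K :=
  omega (vsval (reprv u)) (vsval (reprv v)).

Lemma d1_ker X (z : subvs_of (lker (d1 X))) : d1 X (vsval z) = 0.
Proof. by apply/eqP; rewrite -memv_ker; exact: subvsP. Qed.

Lemma im_d0_in_ker_d1P X (z : subvs_of (lker (d1 X))) :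
  z \in im_d0_in_ker_d1 X -> exists h, vsval z = d0 X h.
Proof.
rewrite /im_d0_in_ker_d1 -memv_preim => /memv_imgP[h _ def_z].
by exists h; rewrite -def_z lfunE.
Qed.

Lemma omega_classl X (x y z : subvs_of (lker (d1 X))) : \dim {:V'} = 1%N ->
  x - y \in im_d0_in_ker_d1 X ->
  omega (vsval x) (vsval z) = omega (vsval y) (vsval z).
Proof.
move=> dimV' /im_d0_in_ker_d1P[h def_xy].
have -> : vsval x = 1 *: d0 X h + vsval y.
  by rewrite scale1r -def_xy; exact/esym/subrK.
by rewrite omegaPl (omega_d0 h dimV' (d1_ker z)) mulr0 add0r.
Qed.

Lemma omega_classr X (x y z : subvs_of (lker (d1 X))) : \dim {:V'} = 1%N ->
  x - y \in im_d0_in_ker_d1 X ->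
  omega (vsval z) (vsval x) = omega (vsval z) (vsval y).
Proof.
move=> dimV' xy.
by rewrite omegaC (omega_classl z dimV' xy) -omegaC.
Qed.

Lemma Omega_class X (x y : subvs_of (lker (d1 X))) : \dim {:V'} = 1%N ->
  Omega (tangent_class x) (tangent_class y) = omega (vsval x) (vsval y).
Proof.
move=> dimV'.
apply: (@reprv_compat2 _ _ (im_d0_in_ker_d1 X) K
  (fun u v => omega (vsval u) (vsval v))).
- by move=> x1 x2 z; exact: omega_classl.
- by move=> x1 x2 z; exact: omega_classr.
Qed.

Definition Omega_flat X (u : tangent X) : 'Hom(tangent X, K^o) :=
  linfun (Omega u : tangent X -> K^o).

Lemma Omega_flatE X u v : \dim {:V'} = 1%N ->
  @Omega_flat X u v = Omega u v.
Proof.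
move=> dimV'; have lin_u : linear (Omega u : tangent X -> K^o).
  move=> k v1 v2; rewrite -[u]reprvK -[v1]reprvK -[v2]reprvK -linearP.
  by rewrite !Omega_class // linearP omegaPr.
pose M := GRing.isLinear.Build _ _ _ _ (Omega u : tangent X -> K^o) lin_u.
pose L : {linear _ -> _} := HB.pack (Omega u : tangent X -> K^o) M.
exact: (lfunE L).
Qed.

(* "Isomorphism" is taken literally: a linear bijection from the tangent space
   to its dual. *)
Definition Omega_nondegenerate X : Prop :=
  linear (@Omega_flat X) /\ bijective (@Omega_flat X).

Lemma Omega_flat_is_linear X : \dim {:V'} = 1%N -> linear (@Omega_flat X).
Proof.
move=> dimV' k u1 u2; apply/lfunP => v.
rewrite add_lfunE scale_lfunE !Omega_flatE //.
rewrite -[u1]reprvK -[u2]reprvK -[v]reprvK -linearP.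
by rewrite !Omega_class // linearP omegaPl.
Qed.

End EnhancedADHM.

(* Main.v *)
(* Write v for a generator of the image of F and w for one of the image of I.
   Stability makes (v, w) a basis of V; then J = 0 (its value at w is a trace of
   a commutator) and A = [[al, de], [0, ga]], B = [[be, ze], [0, ep]] commute,
   with (de, ze) <> 0. So (de, ze) is a nonzero multiple of (al - ga, be - ep)
   when the latter is nonzero, and A and B are both diagonalizable iff the two
   joint eigenvalues (al, be) and (ga, ep) are distinct.
   Modulo im d0 every cocycle has i = 0 and f = 0; its a and b are then upper
   triangular, a' and b' are their first diagonal entries, and
   Omega = 2 (a11 /\ b11) + a22 /\ b22, up to the sign convention.  The only
   remaining cocycle condition is the (v, w) entry of the linearized [A, B] = 0.
   For distinct eigenvalues it can be solved for arbitrary diagonals, so the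
   radical consists of strictly triangular (a12, b12) proportional to (de, ze),
   which is im d0.  For equal eigenvalues every strictly triangular pair is in
   the radical, but only the multiples of (de, ze) are in im d0. *)

From HB Require Import structures.
Require Import Defs.
From mathcomp Require Import all_boot all_order all_algebra.
From mathcomp Require Import reals complex.
From mathcomp Require Import ring.

Set Implicit Arguments.
Unset Strict Implicit.
Unset Printing Implicit Defensive.

Import GRing.Theory Num.Theory.
Import passmx.

Local Open Scope ring_scope.
Local Notation "f ** g" := (comp_lfun f g) (at level 40, left associativity).

(** * Traces and diagonalizability in an arbitrary basis *)

Section Bases.
Variables (K : fieldType) (U : vectType K).
Implicit Types (f : 'End(U)) (e : seq U).

(** The matrices of [f] in [e] and in the canonical basis are conjugate, and the trace is invariant
    under conjugation. *)
Lemma lftrace_basis n (e : n.-tuple U) f :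
  basis_of {:U} e -> lftrace f = \sum_(i < n) coord e i (f e`_i).
Proof.
move=> eb; have En := size_basis eb; subst n.
transitivity (\tr (mxof e e f)); last first.
  apply: eq_bigr => i _; rewrite !mxE /= -[delta_mx _ _]/(delta_mx 0 i).
  by rewrite vecof_delta.
have bb := vbasisP {:U}.
(* Writing [f] as id o f o id and passing through the canonical basis exposes the two transition
   matrices; cyclicity of the trace brings them together, and they cancel. *)
rewrite /lftrace -[in RHS](comp_lfun1r f) -[in RHS](comp_lfun1l (f ** \1)).
rewrite (mxof_comp _ _ bb) (mxof_comp _ _ bb) -mulmxA mxtrace_mulC -mulmxA.
by rewrite -(mxof_comp _ _ eb) comp_lfun1l mxof1 ?mulmx1 // (basis_free bb).
Qed.

Lemma diagonalizable_endP f :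
  diagonalizable_end f <->
  exists2 e, basis_of {:U} e & forall x, x \in e -> exists k, f x = k *: x.
Proof.
split=> [[e eb /is_diag_mxP fe] | [e eb fe]].
  exists e => // x /tnthP[i ->]; exists (mxof e e f i i).
  rewrite (tnth_nth 0) -vecof_delta (hom_vecof _ eb) -rowE.
  rewrite -linearZ; congr vecof; move: (mxof e e f) fe => M fe.
  apply/rowP=> j; rewrite !mxE eqxx.
  case: (eqVneq j i) => [-> | nij] /=; rewrite ?mulr1 // mulr0.
  by apply: fe; rewrite eq_sym.
have sz_e : size e == \dim {:U}.
  by rewrite eq_sym; apply/eqP; exact: (size_basis (X := in_tuple e) eb).
exists (Tuple sz_e) => //; apply/is_diag_mxP => i j nij; rewrite mxE /=.
rewrite -[delta_mx _ _]/(delta_mx 0 i) vecof_delta.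
have [|k ->] := fe (Tuple sz_e)`_i; first by rewrite mem_nth ?size_tuple.
rewrite mxE linearZ /= coord_free ?(basis_free eb) //.
by rewrite -val_eqE (negPf nij) mulr0.
Qed.

End Bases.

(** * Coordinates, traces and diagonalizability on a plane *)

Section Plane.
Variables (K : fieldType) (U : vectType K) (v w : U).
Hypothesis vw : basis_of {:U} [:: v; w].
Implicit Types (x y : U) (f : 'End(U)).

Definition coord1 : U -> K := coord [tuple v; w] ord0.
Definition coord2 : U -> K := coord [tuple v; w] ord_max.
HB.instance Definition _ := GRing.Linear.copy coord1 (coord [tuple v; w] ord0).
HB.instance Definition _ := GRing.Linear.copy coord2 (coord [tuple v; w] ord_max).

Lemma coord12 x : x = coord1 x *: v + coord2 x *: w.
Proof.
rewrite {1}(coord_basis (X := [tuple v; w]) vw (memvf x)).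
by rewrite big_ord_recl big_ord1 /coord2 (_ : lift _ _ = ord_max) //; apply: val_inj.
Qed.

Lemma coord12_inj x y : coord1 x = coord1 y -> coord2 x = coord2 y -> x = y.
Proof. by move=> e1 e2; rewrite (coord12 x) e1 e2 -coord12. Qed.

Let fvw : free [tuple v; w] := basis_free vw.
Lemma coord1v : coord1 v = 1. Proof. exact: (coord_free ord0 ord0 fvw). Qed.
Lemma coord2v : coord2 v = 0. Proof. exact: (coord_free ord0 ord_max fvw). Qed.
Lemma coord1w : coord1 w = 0. Proof. exact: (coord_free ord_max ord0 fvw). Qed.
Lemma coord2w : coord2 w = 1. Proof. exact: (coord_free ord_max ord_max fvw). Qed.

Lemma plane_lfun (T : vectType K) (s t : T) :
  exists f : 'Hom(U, T), f v = s /\ f w = t.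
Proof.
have [f] := linear_of_free [:: v; w] [:: s; t].
move=> /(_ (basis_free vw) erefl) /= [fv fw].
by exists (linfun f); rewrite !lfunE.
Qed.

Lemma plane_lfunP (T : vectType K) (f g : 'Hom(U, T)) :
  f v = g v -> f w = g w -> f = g.
Proof.
by move=> fgv fgw; apply/lfunP => x; rewrite (coord12 x) !linearP !linearZ /= fgv fgw.
Qed.

Lemma plane_app (T : vectType K) (f : 'Hom(U, T)) x :
  f x = coord1 x *: f v + coord2 x *: f w.
Proof. by rewrite {1}(coord12 x) linearP linearZ. Qed.

Lemma plane_lftrace f : lftrace f = coord1 (f v) + coord2 (f w).
Proof.
rewrite (lftrace_basis f (e := [tuple v; w]) vw) big_ord_recl big_ord1.
by rewrite /coord2 (_ : lift _ _ = ord_max) //; apply: val_inj.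
Qed.

(** If p = s, then (f - p)^2 = 0, so p is the only eigenvalue and a diagonalizable [f] must be
    scalar. If p and s differ, a second eigenvector is found by correcting [w] along [v]. *)
Lemma plane_diagonalizable f p r s :
  f v = p *: v -> f w = r *: v + s *: w ->
  diagonalizable_end f <-> p != s \/ r = 0.
Proof.
move=> fv fw; rewrite diagonalizable_endP; split=> [[e eb fe] | ].
  case: (eqVneq p s) => [eps | _]; [right | by left]; subst s.
  suff fE : f = p *: \1%VF.
    have := congr1 (fun g : 'End(U) => coord1 (g w)) fE.
    rewrite fw scale_lfunE id_lfunE linearP !linearZ /= coord1v coord1w.
    by rewrite mulr1 mulr0 addr0.
  (* Cayley-Hamilton for a triangular matrix with both diagonal entries equal to p. *)
  have g2 x : f (f x) = p *: f x + p *: f x - p ^+ 2 *: x.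
    have f1 y : coord1 (f y) = p * coord1 y + r * coord2 y.
      by rewrite (plane_app f y) fv fw !(linearD, linearZ) /= !(coord1v, coord1w); ring.
    have f2 y : coord2 (f y) = p * coord2 y.
      by rewrite (plane_app f y) fv fw !(linearD, linearZ) /= !(coord2v, coord2w); ring.
    by apply: coord12_inj; rewrite !(linearB, linearD, linearZ) /= !(f1, f2); ring.
  apply/(fullv_lfunP _ _ (span_basis eb)) => x xe.
  have [k fx] := fe x xe; rewrite scale_lfunE id_lfunE fx; congr (_ *: _).
  have := g2 x; rewrite fx linearZ /= fx !scalerA -scalerDl -scalerBl.
  move/eqP; rewrite -subr_eq0 -scalerBl scaler_eq0 (negPf (basis_not0 eb xe)) orbF.
  rewrite (_ : _ - _ = (k - p) ^+ 2); last by ring.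
  by rewrite expf_eq0 /= subr_eq0 => /eqP.
case=> [nps | r0]; last first.
  exists [:: v; w] => // x; rewrite !inE => /orP[] /eqP->; first by exists p.
  by exists s; rewrite fw r0 scale0r add0r.
have psN0 : s - p != 0 by rewrite subr_eq0 eq_sym.
(* The coefficient c solves r + c p = s c, which makes w + c v an eigenvector for s. *)
exists [:: v; w + (r / (s - p)) *: v]; last first.
  move=> x; rewrite !inE => /orP[] /eqP->; first by exists p.
  exists s; rewrite linearD linearZ /= fv fw; apply: coord12_inj;
      rewrite !(linearD, linearZ) /= ?(coord1v, coord2v, coord1w, coord2w); by field.
rewrite basisEdim (size_basis (X := [tuple v; w]) vw) andbT.
rewrite -(span_basis vw); apply/span_subvP => x; rewrite !inE.
have vm y : v \in <<[:: v; y]>>%VS by apply: memv_span; rewrite mem_head.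
case/orP=> /eqP->; rewrite ?vm // -[w](addrK ((r / (s - p)) *: v)).
by rewrite rpredB ?rpredZ ?vm // memv_span // addrK !inE eqxx orbT.
Qed.

End Plane.

(** * Coordinates and traces on a line *)

Section Line.
Variables (K : fieldType) (U : vectType K) (e : U).
Hypothesis eb : basis_of {:U} [:: e].

Definition coordL : U -> K := coord [tuple e] ord0.
HB.instance Definition _ := GRing.Linear.copy coordL (coord [tuple e] ord0).

Lemma coordLE x : x = coordL x *: e.
Proof. by rewrite {1}(coord_basis (X := [tuple e]) eb (memvf x)) big_ord1. Qed.

Lemma coordLe : coordL e = 1.
Proof. exact: (coord_free ord0 ord0 (basis_free eb : free [tuple e])). Qed.

Lemma line_lfun (T : vectType K) (s : T) : exists f : 'Hom(U, T), f e = s.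
Proof.
have [f] := linear_of_free [:: e] [:: s].
by move=> /(_ (basis_free eb) erefl) /= [fe]; exists (linfun f); rewrite lfunE.
Qed.

Lemma line_app (T : vectType K) (f : 'Hom(U, T)) x : f x = coordL x *: f e.
Proof. by rewrite {1}(coordLE x) linearZ. Qed.

Lemma line_lfunP (T : vectType K) (f g : 'Hom(U, T)) : f e = g e -> f = g.
Proof. by move=> fg; apply/lfunP => x; rewrite !(line_app _ x) fg. Qed.

Lemma line_lftrace (f : 'End(U)) : lftrace f = coordL (f e).
Proof. by rewrite (lftrace_basis f (e := [tuple e]) eb) big_ord1. Qed.

End Line.

Lemma line_basis (K : fieldType) (U : vectType K) :
  \dim {:U} = 1%N -> exists e : U, basis_of {:U} [:: e].
Proof.
move=> dimU; exists (vpick {:U}).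
by rewrite basisEfree seq1_free vpick0 -dimv_eq0 dimU subvf.
Qed.

(** * Non-degeneracy as a statement about the radical on cocycles *)

Section Nondegenerate.
Variables (K : fieldType) (W V V' : vectType K) (X : adhm_space W V V').
Hypothesis dimV' : \dim {:V'} = 1%N.

(** This removes the quotient: injectivity of the flat map says that a cocycle in the radical of
    [omega] is a coboundary, and bijectivity follows from injectivity because a space and its dual
    have the same dimension. *)
Lemma Omega_nondegenerateP :
  Omega_nondegenerate X <->
  forall x, d1 X x = 0 -> (forall y, d1 X y = 0 -> omega x y = 0) ->
    exists h, x = d0 X h.
Proof.
split=> [[_ /bij_inj inj_flat] x x0 xrad | radX].
  have xker : x \in lker (d1 X) by rewrite memv_ker x0.
  have [|h] := @im_d0_in_ker_d1P _ _ _ _ X (Subvs xker); last by exists h.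
  suff : tangent_class (Subvs xker) = tangent_class (0 : subvs_of (lker (d1 X))).
    by move/eqP; rewrite piv_eq subr0.
  apply: inj_flat; apply/lfunP => u; rewrite !Omega_flatE // -[u]reprvK.
  rewrite !Omega_class // xrad ?d1_ker //.
  (* Semilinearity with scalar -1 at two zero vectors gives omega(0, u) = 0. *)
  have := omegaPl (-1) 0 0 (vsval (reprv u)).
  by rewrite scaler0 add0r mulN1r addNr linear0 => ->.
have lin_flat := @Omega_flat_is_linear _ _ _ _ X dimV'; split=> //.
pose M := GRing.isLinear.Build _ _ _ _ (@Omega_flat _ _ _ _ X) lin_flat.
pose L : {linear _ -> _} := HB.pack (@Omega_flat _ _ _ _ X) M.
have kerL : lker (linfun L) == 0%VS.
  rewrite -subv0; apply/subvP => u; rewrite memv_ker lfunE /= memv0.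
  move=> /eqP u0; rewrite -[u]reprvK.
  have [|y y0|h def_u] := radX (vsval (reprv u)); first exact: d1_ker.
    have yker : y \in lker (d1 X) by rewrite memv_ker y0.
    rewrite -[y]/(vsval (Subvs yker)) -Omega_class // {1}/tangent_class.
    rewrite reprvK -Omega_flatE //.
    by rewrite u0 zero_lfunE.
  rewrite -(linear0 (piv (im_d0_in_ker_d1 X))) piv_eq subr0.
  by rewrite -memv_preim lfunE /= def_u memv_img ?memvf.
have imL : limg (linfun L) = fullv.
  apply/eqP; rewrite eqEdim subvf /= limg_dim_eq ?(eqP kerL) ?capv0 //.
  (* The space of maps to the one-dimensional [K^o] has dimension n * 1. *)
  by rewrite !dimvf /dim /= muln1.
exists (fun g => (linfun L)^-1%VF g) => [u | g].
  by rewrite -[Omega_flat u](lfunE L) lker0_lfunK.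
by rewrite -[LHS](lfunE L) limg_lfunVK // imL memvf.
Qed.

End Nondegenerate.

(** * Cocycles and the 2-form in coordinates at a triangular representation with J = 0 *)

Section NormalForm.
Variables (K : fieldType) (W V V' : vectType K).
Variables (v w : V) (e : W) (e' : V').
Hypotheses (vw : basis_of {:V} [:: v; w]) (eb : basis_of {:W} [:: e]).
Hypothesis e'b : basis_of {:V'} [:: e'].
Variables (A B : 'End(V)) (I : 'Hom(W, V)) (A' B' : 'End(V')) (F : 'Hom(V', V)).
Variables al be ga ep de ze : K.
Hypotheses (Av : A v = al *: v) (Aw : A w = de *: v + ga *: w).
Hypotheses (Bv : B v = be *: v) (Bw : B w = ze *: v + ep *: w).
Hypotheses (Ie : I e = w) (Fe' : F e' = v).
Hypotheses (A'e' : A' e' = al *: e') (B'e' : B' e' = be *: e').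

Let X : adhm_space W V V' := (A, B, I, 0, A', B', F).

Local Notation c1 := (coord1 v w).
Local Notation c2 := (coord2 v w).
Local Notation c := (coordL e).
Local Notation c' := (coordL e').

Let linE := (linearB, linearD, linearN, linearZ).
Let lfE := (comp_lfunE, scale_lfunE, opp_lfunE, add_lfunE, zero_lfunE).
Let coordE := (coord1v vw, coord2v vw, coord1w vw, coord2w vw).

Lemma coord_A x :
  (c1 (A x) = al * c1 x + de * c2 x) * (c2 (A x) = ga * c2 x).
Proof.
by rewrite (plane_app vw A x) Av Aw ?linE /= !coordE; split; ring.
Qed.

Lemma coord_B x :
  (c1 (B x) = be * c1 x + ze * c2 x) * (c2 (B x) = ep * c2 x).
Proof.
by rewrite (plane_app vw B x) Bv Bw ?linE /= ?linE /= !coordE; split; ring.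
Qed.

Lemma coord_I y : (c1 (I y) = 0) * (c2 (I y) = c y).
Proof. by rewrite (line_app eb I y) Ie ?linE /= !coordE; split; ring. Qed.

Lemma coord_F z : (c1 (F z) = c' z) * (c2 (F z) = 0).
Proof. by rewrite (line_app e'b F z) Fe' ?linE /= !coordE; split; ring. Qed.

Let coordXE := (coord_A, coord_B, coord_I, coord_F).

Ltac coords := rewrite ?lfE ?linE /= ?(Av, Bv, Aw, Bw, Ie, Fe', A'e', B'e');
  rewrite ?linE /= ?coordXE ?linear0 ?coordE.

(** These are the matrix entries of the components of [d1]: four for the linearized moment map, two
    for each intertwining relation, one for JF = 0. Since J = 0 at the base point, the terms iJ and
    Jf vanish; since [A'], [B'] share the eigenvalues of [A], [B] at [v], the first coordinate of
    [f e'] cancels. *)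
Lemma ker_d1P a b i j a' b' f :
  d1 X (a, b, i, j, a', b', f) = 0 <->
  [/\ [/\ de * c2 (b v) - ze * c2 (a v) = 0,
          (be - ep) * c2 (a v) - (al - ga) * c2 (b v) + c (j v) = 0,
          ze * (c1 (a v) - c2 (a w)) - de * (c1 (b v) - c2 (b w))
          + (al - ga) * c1 (b w) - (be - ep) * c1 (a w) = 0
        & ze * c2 (a v) - de * c2 (b v) + c (j w) = 0],
      c1 (a v) = c' (a' e') - de * c2 (f e') /\
      c2 (a v) = (al - ga) * c2 (f e'),
      c1 (b v) = c' (b' e') - ze * c2 (f e') /\
      c2 (b v) = (be - ep) * c2 (f e')
    & c (j v) = 0].
Proof.
rewrite lfunE /= /lfcomm; split=> [[E1 E2 E3 E4] | ].
  split; [split | split | split | ].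
  - have := congr1 (fun g : 'End(V) => c1 (g v)) E1; coords.
    by move=> E; rewrite -[RHS]E; ring.
  - have := congr1 (fun g : 'End(V) => c2 (g v)) E1; coords.
    by move=> E; rewrite -[RHS]E; ring.
  - have := congr1 (fun g : 'End(V) => c1 (g w)) E1; coords.
    by move=> E; rewrite -[RHS]E; ring.
  - have := congr1 (fun g : 'End(V) => c2 (g w)) E1; coords.
    by move=> E; rewrite -[RHS]E; ring.
  - have := congr1 (fun g : 'Hom(V', V) => c1 (g e')) E2; coords; move=> E.
    by apply/eqP; rewrite -subr_eq0 -E; apply/eqP; ring.
  - have := congr1 (fun g : 'Hom(V', V) => c2 (g e')) E2; coords; move=> E.
    by apply/eqP; rewrite -subr_eq0 -E; apply/eqP; ring.
  - have := congr1 (fun g : 'Hom(V', V) => c1 (g e')) E3; coords; move=> E.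
    by apply/eqP; rewrite -subr_eq0 -E; apply/eqP; ring.
  - have := congr1 (fun g : 'Hom(V', V) => c2 (g e')) E3; coords; move=> E.
    by apply/eqP; rewrite -subr_eq0 -E; apply/eqP; ring.
  - by have := congr1 (fun g : 'Hom(V', W) => c (g e')) E4; coords; rewrite addr0.
case=> -[E1 E2 E3 E4] [a1 a2] [b1 b2] j0.
congr (_, _, _, _).
- apply: (plane_lfunP vw); apply: (coord12_inj vw); coords.
  + by rewrite -[RHS]E1; ring.
  + by rewrite -[RHS]E2; ring.
  + by rewrite -[RHS]E3; ring.
  + by rewrite -[RHS]E4; ring.
- by apply: (line_lfunP e'b); apply: (coord12_inj vw); coords; rewrite ?a1 ?a2; ring.
- by apply: (line_lfunP e'b); apply: (coord12_inj vw); coords; rewrite ?b1 ?b2; ring.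
- by apply: (line_lfunP e'b); coords; rewrite addr0 (coordLE eb (j v)) j0 scale0r.
Qed.

Lemma lftrace_comp_plane (f g : 'End(V)) :
  lftrace (f ** g) = c1 (f v) * c1 (g v) + c1 (f w) * c2 (g v)
                     + c2 (f v) * c1 (g w) + c2 (f w) * c2 (g w).
Proof.
rewrite (plane_lftrace vw) !comp_lfunE (plane_app vw f (g v)).
by rewrite (plane_app vw f (g w)) !(linearD, linearZ) /=; ring.
Qed.

Lemma lftrace_comp_line (f g : 'End(V')) :
  lftrace (f ** g) = c' (f e') * c' (g e').
Proof.
by rewrite (line_lftrace e'b) comp_lfunE (line_app e'b f (g e')) linearZ /= mulrC.
Qed.

Lemma lftrace_comp_line_plane (f : 'Hom(W, V)) (g : 'Hom(V, W)) :
  lftrace (f ** g) = c1 (f e) * c (g v) + c2 (f e) * c (g w).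
Proof.
rewrite (plane_lftrace vw) !comp_lfunE (line_app eb f (g v)).
by rewrite (line_app eb f (g w)) !linearZ /=; ring.
Qed.

Lemma omega_coord a1 b1 i1 j1 a1' b1' f1 a2 b2 i2 j2 a2' b2' f2 :
  omega (a1, b1, i1, j1, a1', b1', f1 : 'Hom(V', V))
        (a2, b2, i2, j2, a2', b2', f2) =
  c1 (b2 v) * c1 (a1 v) + c1 (b2 w) * c2 (a1 v)
  + c2 (b2 v) * c1 (a1 w) + c2 (b2 w) * c2 (a1 w)
  - (c1 (a2 v) * c1 (b1 v) + c1 (a2 w) * c2 (b1 v)
     + c2 (a2 v) * c1 (b1 w) + c2 (a2 w) * c2 (b1 w))
  - (c (j1 v) * c1 (i2 e) + c (j1 w) * c2 (i2 e))
  + (c (j2 v) * c1 (i1 e) + c (j2 w) * c2 (i1 e))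
  + (c' (b2' e') * c' (a1' e') - c' (a2' e') * c' (b1' e')).
Proof.
rewrite /omega !(linearD, linearN) /= !lftrace_comp_line.
by rewrite !lftrace_comp_plane !lftrace_comp_line_plane; ring.
Qed.

(** * The radical, for commuting [A], [B] without [w] as a common eigenvector *)

Hypothesis comm_AB : (al - ga) * ze = (be - ep) * de.
Hypothesis cyclic_w : de != 0 \/ ze != 0.

(** The cocycle equations kill [j] and the lower left entries; pairing with cocycles of arbitrary
    diagonal kills the diagonals; the equation left over forces the upper right entries to be those
    of a coboundary. *)
Lemma radical_reduced a b j a' b' (x := (a, b, 0, j, a', b', 0)) :
  2 != 0 :> K -> al != ga \/ be != ep ->
  d1 X x = 0 -> (forall y, d1 X y = 0 -> omega x y = 0) ->
  exists h, x = d0 X h.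
Proof.
move=> two_neq0 distinct /ker_d1P; rewrite !lfE !linear0 !mulr0 !subr0.
case=> -[_ _ E3 E4] [a1 a2] [b1 b2] j1 xrad.
move: E4; rewrite a2 b2 !mulr0 subr0 add0r => j2.
(* Pairing with the triangular cocycle of diagonals (p, s) and (P, S). The factor 2 arises because
   the first diagonal entry recurs as the scalar on [V']. *)
have test p s P S : P * c1 (a v) *+ 2 + S * c2 (a w)
                    - (p * c1 (b v) *+ 2 + s * c2 (b w)) = 0.
  (* The upper right entries r, R must satisfy the one remaining cocycle equation; distinct
     eigenvalue pairs give one of them an invertible coefficient. *)
  have [r [R rR]] : exists r R, ze * (p - s) - de * (P - S) + (al - ga) * R
                               - (be - ep) * r = 0.
    have [eq_al | ne_al] := eqVneq al ga; last first.
      exists 0, ((de * (P - S) - ze * (p - s)) / (al - ga)).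
      by rewrite -subr_eq0 in ne_al; field.
    have ne_be : be - ep != 0 by rewrite subr_eq0; case: distinct => //; rewrite eq_al eqxx.
    exists ((ze * (p - s) - de * (P - S)) / (be - ep)), 0.
    by field.
  have [a0 [a0v a0w]] := plane_lfun vw (p *: v) (r *: v + s *: w).
  have [b0 [b0v b0w]] := plane_lfun vw (P *: v) (R *: v + S *: w).
  have [a0' a0e'] := line_lfun e'b (p *: e').
  have [b0' b0e'] := line_lfun e'b (P *: e').
  have := xrad (a0, b0, 0, 0, a0', b0', 0); rewrite omega_coord.
  rewrite !lfE a0v a0w b0v b0w a0e' b0e' !(linearD, linearZ, linear0) /=.
  rewrite !coordE (coordLe e'b) a2 b2 -a1 -b1 => rad_eq.
  rewrite -[RHS]rad_eq; first by ring.
  apply/ker_d1P; rewrite !lfE a0v a0w b0v b0w a0e' b0e'.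
  rewrite !(linearD, linearZ, linear0) /= !coordE (coordLe e'b).
  by split; [split | split | split | ]; (ring || (rewrite -[RHS]rR; ring)).
have a11 : c1 (a v) = 0.
  have /eqP := test 0 0 1 0; rewrite !(mul0r, mul1r, mul0rn, addr0, subr0).
  by rewrite -mulr_natl mulf_eq0 (negPf two_neq0) => /eqP.
have b11 : c1 (b v) = 0.
  have /eqP := test 1 0 0 0.
  rewrite !(mul0r, mul1r, mul0rn, addr0, add0r, sub0r) oppr_eq0.
  by rewrite -mulr_natl mulf_eq0 (negPf two_neq0) => /eqP.
have a22 : c2 (a w) = 0.
  by have := test 0 0 0 1; rewrite !(mul0r, mul1r, mul0rn, addr0, add0r, subr0).
have b22 : c2 (b w) = 0.
  have /eqP := test 0 1 0 0.
  by rewrite !(mul0r, mul1r, mul0rn, addr0, add0r, sub0r) oppr_eq0 => /eqP.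
move: E3; rewrite a11 b11 a22 b22 !subrr !mulr0 subrr add0r => E3.
(* By [E3] and [comm_AB], both (a12, b12) and (de, ze) lie on the line spanned by the nonzero vector
   (al - ga, be - ep), and (de, ze) is nonzero. *)
have [t [ta tb]] : exists t, c1 (a w) = t * de /\ c1 (b w) = t * ze.
  have [de0 | nde] := eqVneq de 0.
    have nze : ze != 0 by case: cyclic_w => //; rewrite de0 eqxx.
    exists (c1 (b w) / ze); rewrite divfK // de0 mulr0; split=> //.
    move/eqP: comm_AB; rewrite de0 mulr0 mulf_eq0 (negPf nze) orbF => /eqP al0.
    move/eqP: E3; rewrite al0 mul0r sub0r oppr_eq0 mulf_eq0 => /orP[] /eqP // be0.
    by case: distinct; rewrite -subr_eq0 ?al0 ?be0 eqxx.
  exists (c1 (a w) / de); rewrite divfK //; split=> //.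
  have [al0 | nal] := eqVneq (al - ga) 0.
    case: distinct; rewrite -subr_eq0 ?al0 ?eqxx // => nbe.
    move/esym/eqP: comm_AB; rewrite al0 mul0r mulf_eq0 (negPf nbe).
    by rewrite (negPf nde).
  apply: (mulfI nal); move/eqP: E3; rewrite subr_eq0 => /eqP ->.
  by rewrite mulrCA comm_AB; field.
(* With h = diag(t, 0) and h' = t, both hI and hF - Fh' vanish, while [h, A] and [h, B] have upper
   right entries t de and t ze. *)
have [h [hv hw]] := plane_lfun vw (t *: v) (0 : V).
exists (h, t *: \1%VF); rewrite lfunE /= /lfcomm.
congr (_, _, _, _, _, _, _).
- apply: (plane_lfunP vw); apply: (coord12_inj vw); rewrite !lfE ?hv ?hw;
    coords; rewrite ?hv ?hw ?linE /= ?linear0 ?coordE ?(a11, a2, ta, a22); ring.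
- apply: (plane_lfunP vw); apply: (coord12_inj vw); rewrite !lfE ?hv ?hw;
    coords; rewrite ?hv ?hw ?linE /= ?linear0 ?coordE ?(b11, b2, tb, b22); ring.
- by apply: (line_lfunP eb); rewrite !lfE Ie hw.
- apply: (plane_lfunP vw); rewrite !lfE oppr0.
    by rewrite [j v](coordLE eb) j1 scale0r.
  by rewrite [j w](coordLE eb) j2 scale0r.
- rewrite -/(lfcomm _ _) (lfcomm_dim1 _ _ (size_basis (X := [tuple e']) e'b)).
  apply: (line_lfunP e'b); rewrite lfE [LHS](coordLE e'b).
  by rewrite -a1 a11 scale0r.
- rewrite -/(lfcomm _ _) (lfcomm_dim1 _ _ (size_basis (X := [tuple e']) e'b)).
  apply: (line_lfunP e'b); rewrite lfE [LHS](coordLE e'b).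
  by rewrite -b1 b11 scale0r.
- by apply: (line_lfunP e'b); rewrite !lfE id_lfunE linearZ /= Fe' hv subrr.
Qed.

(** Coboundaries are cocycles in the radical of [omega], so subtracting one preserves the hypotheses
    and allows the reduction to i = 0 and f = 0. *)
Lemma radical_im_d0 x :
  adhm_representation X -> 2 != 0 :> K -> al != ga \/ be != ep ->
  d1 X x = 0 -> (forall y, d1 X y = 0 -> omega x y = 0) ->
  exists h, x = d0 X h.
Proof.
move=> Xrep two_neq0 distinct.
case: x => [[[[[[a b] i] j] a'] b'] f] dx xrad.
(* As [F e'] and [I e] form the basis (v, w), this [h0] satisfies h0 F = f and h0 I = i. *)
have [h0 [h0v h0w]] := plane_lfun vw (f e') (i e).
have dimV' : \dim {:V'} = 1%N := size_basis (X := [tuple e']) e'b.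
pose x0 : adhm_space W V V' := -1 *: d0 X (h0, 0) + (a, b, i, j, a', b', f).
have dx0 : d1 X x0 = 0 by rewrite linearP /= dx d1_d0 // scaler0 addr0.
have x0rad y : d1 X y = 0 -> omega x0 y = 0.
  by move=> dy; rewrite omegaPl omega_d0 // mulr0 add0r xrad.
have i0 : -1 *: (h0 ** I) + i = 0.
  by apply: (line_lfunP eb); rewrite !lfE Ie h0w scaleN1r addNr.
have f0 : -1 *: (h0 ** F - F ** 0) + f = 0.
  by apply: (line_lfunP e'b); rewrite !lfE Fe' h0v linear0 subr0 scaleN1r addNr.
have def_x0 : x0 = (-1 *: lfcomm h0 A + a, -1 *: lfcomm h0 B + b, 0,
    -1 *: (- (0 ** h0)) + j, -1 *: lfcomm 0 A' + a', -1 *: lfcomm 0 B' + b', 0).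
  by rewrite -i0 -f0 /x0 lfunE.
have [h def_h] : exists h, x0 = d0 X h.
  by rewrite def_x0 in dx0 x0rad *; exact: radical_reduced.
exists (h + (h0, 0)); rewrite linearD /= -def_h /x0 scaleN1r addrAC addNr.
by rewrite add0r.
Qed.

Lemma radical_not_im_d0 : al = ga -> be = ep ->
  exists x, [/\ d1 X x = 0, forall y, d1 X y = 0 -> omega x y = 0
              & ~ exists h, x = d0 X h].
Proof.
move=> eq_al eq_be.
(* A strictly triangular pair (r, R) is chosen off the line of (de, ze), which contains those of all
   coboundaries. *)
have [r [R rR]] : exists r R, r * ze != R * de.
  have [de0 | nde] := eqVneq de 0.
    by exists 1, 0; rewrite mul1r mul0r; case: cyclic_w => //; rewrite de0 eqxx.
  by exists 0, 1; rewrite mul0r mul1r eq_sym.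
have [a [av aw]] := plane_lfun vw (0 : V) (r *: v).
have [b [bv bw]] := plane_lfun vw (0 : V) (R *: v).
exists (a, b, 0, 0, 0, 0, 0); split.
- apply/ker_d1P; rewrite av aw bv bw !lfE !linearZ !linear0 /= !coordE.
  by rewrite eq_al eq_be; split; [split | split | split | ]; ring.
(* A strictly upper triangular pair only meets the lower left entries of the test cocycle, which
   vanish when the eigenvalues coincide. *)
- case=> [[[[[[a2 b2] i2] j2] a2'] b2'] f2] /ker_d1P[_ [_ a2v] [_ b2v] _].
  rewrite omega_coord av aw bv bw a2v b2v !lfE !linearZ !linear0 /= !coordE.
  by rewrite eq_al eq_be; ring.
(* For a coboundary, hI = 0 gives h w = 0 and hF = Fh' gives h v = k v, whence (r, R) = k (de, ze),
   a contradiction. *)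
case=> -[h h']; rewrite lfunE /= /lfcomm => -[ea eb' hI _ _ _ hF].
have hw : h w = 0 by have := congr1 (fun g : 'Hom(W, V) => g e) hI; rewrite !lfE Ie.
have hv : h v = c' (h' e') *: v.
  have := congr1 (fun g : 'Hom(V', V) => g e') hF; rewrite !lfE Fe'.
  by move/esym/eqP; rewrite subr_eq0 (line_app e'b F) Fe' => /eqP.
have := congr1 (fun g : 'End(V) => c1 (g w)) ea.
have := congr1 (fun g : 'End(V) => c1 (g w)) eb'.
rewrite aw bw !lfE hw Aw Bw !linE /= hv hw !linE /= !linear0 !coordE => eR er.
by case/eqP: rR; rewrite -[r]mulr1 -[R]mulr1 er eR; ring.
Qed.

End NormalForm.

(** * Consequences of stability: an adapted basis and J = 0 *)

Section Stability.
Variables (K : fieldType) (W V V' : vectType K).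
Variables (A B : 'End(V)) (I : 'Hom(W, V)) (J : 'Hom(V, W)).
Variables (A' B' : 'End(V')) (F : 'Hom(V', V)) (e : W) (e' : V').
Hypotheses (eb : basis_of {:W} [:: e]) (e'b : basis_of {:V'} [:: e']).
Hypotheses (dimV : \dim {:V} = 2).
Hypothesis Xrep : adhm_representation (A, B, I, J, A', B', F).
Hypothesis Xst : adhm_stable (A, B, I, J, A', B', F).

Let v := F e'.
Let w := I e.

Lemma intertwine_line (C : 'End(V)) (C' : 'End(V')) :
  C ** F - F ** C' = 0 -> C v = coordL e' (C' e') *: v /\
  C' e' = coordL e' (C' e') *: e'.
Proof.
move=> /(congr1 (fun g : 'Hom(V', V) => g e')).
rewrite add_lfunE opp_lfunE !comp_lfunE zero_lfunE => /eqP.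
rewrite subr_eq0 => /eqP Cv; split; last exact: (coordLE e'b).
by rewrite Cv (line_app e'b F).
Qed.

(** Otherwise the span of [x], of dimension at most 1, would be a proper invariant subspace
    containing the image of [I]. *)
Lemma stable_line (x : V) a b :
  A x = a *: x -> B x = b *: x -> w \notin <[x]>%VS.
Proof.
move=> Ax Bx; apply/negP => wx; case: Xst => _; case; exists <[x]>%VS.
have xx := memv_line x; rewrite !limg_line Ax Bx -!memvE !rpredZ //.
split=> //.
  by apply/eqP => /(congr1 (fun S : {vspace V} => \dim S));
    rewrite dim_vline dimV; case: (x != 0).
by rewrite -(span_basis eb) limg_span span_seq1 -memvE.
Qed.

(** The vector [v] is nonzero by injectivity of [F] and is a common eigenvector, so [w] lies off its
    line. *)
Lemma stable_basis : basis_of {:V} [:: v; w].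
Proof.
case: Xrep => _ _ /intertwine_line[Av _] /intertwine_line[Bv _] _.
have wv := stable_line Av Bv; have [injF _] := Xst.
have v0 : v != 0.
  by rewrite -(linear0 F) (inj_eq injF) (basis_not0 e'b) ?mem_head.
rewrite (@perm_basis _ _ _ [:: w; v]); last first.
  by apply/permP => p /=; rewrite addnCA.
by rewrite basisEfree free_cons span_seq1 wv seq1_free v0 subvf dimV.
Qed.

(** JF = 0 handles [v]; the trace of [A, B] + IJ = 0 is the coefficient of [J w], since commutators
    are traceless. *)
Lemma stable_J0 : J = 0.
Proof.
have vw := stable_basis; case: Xrep => AB _ _ _ JF.
have Jv : J v = 0.
  by rewrite -comp_lfunE JF zero_lfunE.
apply: (plane_lfunP vw); rewrite zero_lfunE //.
have := congr1 (@lftrace _ _) AB; rewrite linearD linearB /= lftraceC subrr add0r.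
rewrite (lftrace_comp_line_plane vw eb) coord1w // coord2w //.
rewrite mul0r mul1r add0r linear0 => Jw.
by rewrite [J w](coordLE eb) Jw scale0r.
Qed.

End Stability.

(** * Putting a stable representation into normal form and comparing the criteria *)

Theorem proposition27 (R : realType) (W V V' : vectType R[i])
    (dimW : \dim {:W}%VS = 1%N) (dimV : \dim {:V}%VS = 2%N)
    (dimV' : \dim {:V'}%VS = 1%N)
    (A B : 'End(V)) (I : 'Hom(W, V)) (J : 'Hom(V, W))
    (A' B' : 'End(V')) (F : 'Hom(V', V)) :
  adhm_representation (A, B, I, J, A', B', F) ->
  adhm_stable (A, B, I, J, A', B', F) ->
  (Omega_nondegenerate (A, B, I, J, A', B', F) <->
   diagonalizable_end A /\ diagonalizable_end B).
Proof.
move=> Xrep Xst; rewrite Omega_nondegenerateP //.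
have [e eb] := line_basis dimW; have [e' e'b] := line_basis dimV'.
have vw := stable_basis eb e'b dimV Xrep Xst.
have J0 := stable_J0 eb e'b dimV Xrep Xst; subst J.
have [AB _ AF BF _] := Xrep.
have [Av A'e'] := intertwine_line e'b AF.
have [Bv B'e'] := intertwine_line e'b BF.
have stw := stable_line eb dimV Xst.
set v := F e' in vw Av Bv; set w := I e in vw stw.
set al := coordL _ _ in Av A'e'; set be := coordL _ _ in Bv B'e'.
have Aw := coord12 vw (A w); have Bw := coord12 vw (B w).
set de := coord1 _ _ _ in Aw; set ga := coord2 _ _ _ in Aw.
set ze := coord1 _ _ _ in Bw; set ep := coord2 _ _ _ in Bw.
(* If both vanished, [w] would be a common eigenvector, which [stable_line] excludes because [w]
   lies on its own line. *)
have cyc : de != 0 \/ ze != 0.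
  apply/orP; rewrite -negb_and; apply/negP => /andP[/eqP de0 /eqP ze0].
  move: Aw Bw; rewrite de0 ze0 !scale0r !add0r => Aw Bw.
  by have := stw _ _ _ Aw Bw; rewrite memv_line.
(* The upper right entry of [A, B] = 0. *)
have comm : (al - ga) * ze = (be - ep) * de.
  have := congr1 (fun g : 'End(V) => coord1 v w (g w)) AB.
  rewrite /lfcomm !(add_lfunE, opp_lfunE, comp_lfunE, zero_lfunE).
  rewrite !linear0 addr0 linearB /= !(coord_A vw Av Aw, coord_B vw Bv Bw).
  rewrite (coord1w vw) (coord2w vw) => E.
  by apply/eqP; rewrite -subr_eq0 -E; apply/eqP; ring.
have two0 : 2 != 0 :> R[i] by rewrite pnatr_eq0.
rewrite (plane_diagonalizable vw Av Aw) (plane_diagonalizable vw Bv Bw).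
have diagE : (al != ga \/ de = 0) /\ (be != ep \/ ze = 0) <-> al != ga \/ be != ep.
  have [eal | nal] := eqVneq al ga; have [ebe | nbe] := eqVneq be ep.
  - by split=> [[[] // d0 [] // z0] | []//]; case: cyc; rewrite ?d0 ?z0 eqxx.
  - split=> _; first by right.
    split; last by left.
    right; move/esym/eqP: comm; rewrite eal subrr mul0r mulf_eq0 subr_eq0.
    by rewrite (negPf nbe) => /eqP.
  - split=> _; first by left.
    split; first by left.
    right; move/eqP: comm; rewrite ebe subrr mul0r mulf_eq0 subr_eq0.
    by rewrite (negPf nal) => /eqP.
  - by split=> _; [left | split; left].
rewrite diagE; split=> [radX | ne x]; last first.
  exact: (radical_im_d0 vw eb e'b Av Aw Bv Bw).
have [eal | nal] := eqVneq al ga; last by left.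
have [ebe | nbe] := eqVneq be ep; last by right.
have [x [dx xrad []]] := radical_not_im_d0 vw eb e'b Av Aw Bv Bw (erefl w)
  (erefl v) A'e' B'e' cyc eal ebe.
exact: radX.
Qed.
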